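(* Let $\Phi$ be a semiflow relation on a compact metric space $X$. Let $\mathcal{A}$ denote either of the operators $\mathcal{G}$ or $\mathcal{C}$ on relations. (a) Assume that $A, B$ are disjoint, closed subsets of $X$ with $A$ invariant for $\phi^I \cup \mathcal{A}(\phi^J)$ and $B$ + invariant for $(\phi^I \cup \mathcal{A}(\phi^J))^{-1}$. There exists a continuous function $L: X \to [0,1]$ with $B = L^{-1}(0)$, $A = L^{-1}(1)$ and such that if $(x,y) \in \phi^I \cup \mathcal{A}(\phi^J)$ with $x \neq y$, then $L(y) \ge L(x)$ with equality only when $$x,y \in A, \quad \text{or} \quad x,y \in B, \quad \text{or} \quad (y,x) \in \mathcal{A}(\phi^J).$$ In particular, $L$ is a Lyapunov function for $\mathcal{A}(\phi^J)$ with $|\mathcal{A}(\phi^J)| \subset |L| \subset |\mathcal{A}(\phi^J)| \cup A \cup B$. (b) There exists a continuous function $L: X \to [0,1]$ such that if $(x,y) \in \phi^I \cup \mathcal{A}(\phi^J)$ with $x \neq y$, then $L(y) \ge L(x)$ with equality only when, in addition, $(y,x) \in \mathcal{A}(\phi^J)$. In particular, $L$ is a Lyapunov function for $\mathcal{A}(\phi^J)$ with $|L| = |\mathcal{A}(\phi^J)|$.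
   Context: A relation on $X$ is a subset $R\subset X\times X$, closed if a closed subset; $R(x)=\{y:(x,y)\in R\}$, $R(A)=\bigcup_{x\in A}R(x)$, $R^{-1}=\{(y,x):(x,y)\in R\}$, $R^n$ the $n$-fold composition. $A$ is + invariant for $R$ if $R(A)\subset A$, invariant if $R(A)=A$. A semiflow relation on $X$ is a closed subset $\Phi\subset X\times[0,\infty)\times X$ such that, with $\phi^t=\{(x,y):(x,t,y)\in\Phi\}$: $\phi^0$ is the diagonal $1_X$, and $\phi^{t_1}\circ\phi^{t_2}=\phi^{t_1+t_2}$ for all $t_1,t_2\ge0$. For compact $K\subset[0,\infty)$, $\phi^K=\bigcup_{t\in K}\phi^t$ (a closed relation); $I=[0,1]$, $J=[1,2]$. For a closed relation $R$: $\mathcal{G}R$ is the smallest closed transitive relation containing $R$; $\mathcal{C}R=\bigcap_{\epsilon>0}\mathcal{O}(V_\epsilon\circ R)$ where $\mathcal{O}Q=\bigcup_{n\ge1}Q^n$ and $V_\epsilon=\{(x,y):d(x,y)<\epsilon\}$. $|R|=\{x:(x,x)\in R\}$. A continuous $L:X\to\mathbb{R}$ is a Lyapunov function for a relation $R$ if $(x,y)\in R$ implies $L(x)\le L(y)$. $|L|$ is the set of critical points of $L$ with respect to $R$ (here $R=\mathcal{A}(\phi^J)$), i.e. the points $x$ for which $\sup L|R^{-1}(x)<L(x)<\inf L|R(x)$ fails ($\sup\emptyset=-\infty$, $\inf\emptyset=\infty$). *)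

(* Defs.v *)
From HB Require Import structures.
From mathcomp Require Import all_boot all_order all_algebra.
From mathcomp Require Import all_classical all_reals all_analysis.

Set Implicit Arguments.
Unset Strict Implicit.
Unset Printing Implicit Defensive.

Import Order.TTheory GRing.Theory Num.Theory.
Import numFieldNormedType.Exports.

Local Open Scope classical_set_scope.
Local Open Scope relation_scope.
Local Open Scope ring_scope.

(* A relation on X is a term of type set (X * X).  MathComp's [P \; Q] is
   composition in the order of functions: (x, y) belongs to it iff
   Q (x, z) and P (z, y) for some z. *)

Section Relations.
Context {X : Type}.
Implicit Types (Q : set (X * X)) (A : set X).

Definition rel_diag : set (X * X) := [set xy | xy.1 = xy.2].

Definition rel_inv Q : set (X * X) := (Q^-1)%relation.

Definition rel_at Q (x : X) : set X := [set y | Q (x, y)].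

Definition rel_image Q A : set X := \bigcup_(x in A) rel_at Q x.

Fixpoint rel_pow Q (n : nat) : set (X * X) :=
  if n is m.+1 then Q \; rel_pow Q m else rel_diag.

(* The orbit relation \mathcal{O}Q. *)
Definition rel_orbit Q : set (X * X) :=
  \bigcup_(n in [set n | (1 <= n)%N]) rel_pow Q n.

Definition rel_transitive Q : Prop := Q \; Q `<=` Q.

(* The set |Q|. *)
Definition cyclic_set Q : set X := [set x | Q (x, x)].

Definition rel_plus_invariant Q A : Prop := rel_image Q A `<=` A.

Definition rel_invariant Q A : Prop := rel_image Q A = A.

End Relations.

Definition rel_G {X : topologicalType} (Q : set (X * X)) : set (X * X) :=
  smallest [set P : set (X * X) | closed P /\ rel_transitive P] Q.

(* The strict entourage V_e of the metric. *)
Definition rel_V {R : realType} {X : metricType R} (e : R) : set (X * X) :=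
  [set xy | mdist xy.1 xy.2 < e].

Definition rel_C {R : realType} {X : metricType R} (Q : set (X * X)) :
    set (X * X) :=
  \bigcap_(e in [set e : R | 0 < e]) rel_orbit (rel_V e \; Q).

Section Semiflow.
Context {R : realType} {X : topologicalType}.
Implicit Types Phi : set (X * R * X).

Definition time_rel Phi (t : R) : set (X * X) :=
  [set xy | Phi (xy.1, t, xy.2)].

Definition time_rel_on Phi (K : set R) : set (X * X) :=
  \bigcup_(t in K) time_rel Phi t.

(* Since [0, +oo) is closed in R, a subset of X * [0, +oo) * X is closed there
   iff it is closed in X * R * X. *)
Record semiflow_relation Phi : Prop := SemiflowRelation {
  semiflow_time_ge0 : forall x t y, Phi (x, t, y) -> 0 <= t;
  semiflow_closed : closed Phi;
  semiflow_id : time_rel Phi 0 = rel_diag;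
  semiflow_comp : forall t1 t2 : R, 0 <= t1 -> 0 <= t2 ->
    time_rel Phi t1 \; time_rel Phi t2 = time_rel Phi (t1 + t2)
}.

Definition phiI Phi : set (X * X) := time_rel_on Phi `[0, 1].
Definition phiJ Phi : set (X * X) := time_rel_on Phi `[1, 2].

End Semiflow.

Section Lyapunov.
Context {R : realType} {X : topologicalType}.
Implicit Types (Q : set (X * X)) (L : X -> R).

Definition lyapunov_function Q L : Prop :=
  continuous L /\ forall x y, Q (x, y) -> L x <= L y.

(* The bounds are taken in \bar R, where the supremum of the empty set is -oo
   and its infimum is +oo. *)
Definition critical_set Q L : set X :=
  [set x | ~ ((ereal_sup [set (L y)%:E | y in rel_at (rel_inv Q) x] < (L x)%:E)%E /\
              ((L x)%:E < ereal_inf [set (L y)%:E | y in rel_at Q x])%E)].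

End Lyapunov.

(* Main.v *)
Require Import Defs.
From HB Require Import structures.
From mathcomp Require Import all_boot all_order all_algebra.
From mathcomp Require Import all_classical all_reals all_analysis.
From mathcomp Require Import lra ring.

Set Implicit Arguments.
Unset Strict Implicit.
Unset Printing Implicit Defensive.

Import Order.TTheory GRing.Theory Num.Theory.
Import numFieldNormedType.Exports.

Local Open Scope classical_set_scope.
Local Open Scope ring_scope.

(** Write [P] for the relation obtained from phi^J by the operator, and
    [F := phiI Phi `|` P]. The theorem holds because [F] is a closed preorder,
    and because closed preorders on a compact metric space have enough monotone
    continuous functions.

    [F] is a preorder. The operator is used only through four facts
    ([operator_props]): [P] is closed, transitive, contains the orbit of phi^J,
    and absorbs phi^I on both sides. Absorption starts from phi^I o phi^J and
    phi^J o phi^I, which only involve times at least one and so lie in the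
    orbit of phi^J. For G it extends to [P] because a pair of [P] begins and
    ends with a phi^J-step ([rel_G_first], [rel_G_last]); for C chains are
    perturbed by means of the upper semicontinuity of phi^J and its inverse
    ([rel_C_absorbs]). If [x <> y] are related by [F] both ways then
    [P (y, x)], since a loop inside phi^I can be run until its time exceeds one
    ([phiIU_sym]).

    Separation ([monotone_separation], due to Nachbin). A closed up-set and a
    disjoint closed set are separated by a continuous [F]-monotone function
    with values in [0, 1]. The proof is the dyadic construction of Urysohn,
    with the inclusion of closures in interiors replaced by the relation
    [well_below], which interpolates.

    Strictness ([strict_lyapunov]). When [F (y, x)] fails, [x] is outside [A]
    and [y] is outside [B], the sets [A] with the future of [y] and [B] with
    the past of [x] are disjoint, so that some function vanishing on [B] and
    equal to 1 on [A] is 0 at [x] and 1 at [y]. By the Lindelof property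
    countably many functions serve all such pairs, and their mean with weights
    [2 ^- n.+1] is strict at all of them simultaneously. The same argument makes
    its values differ from 0 off [B] and from 1 off [A].

    A point [x] outside [A], [B] and the cyclic set is regular: an equality
    [L x = L y] with [P (x, y)] would give [P (y, x)], hence [P (x, x)], and
    compactness turns pointwise strict inequalities into strict inequalities
    for the supremum and the infimum ([noncritical]). Part (b) is part (a) with
    [A] and [B] empty. *)

(** * Closed relations on a compact space *)

Lemma closed_preimage {S T : topologicalType} (f : S -> T) (C : set T) :
  continuous f -> closed C -> closed (f @^-1` C).
Proof. by move=> cf; apply: preimage_closed => x _; exact: cf. Qed.

Lemma continuous_pair {S T U : topologicalType} (f : S -> T) (g : S -> U) :
  continuous f -> continuous g -> continuous (fun x => (f x, g x)).
Proof. by move=> cf cg x; apply: cvg_pair; [exact: cf|exact: cg]. Qed.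

Lemma continuous_fst {S T : topologicalType} : continuous (@fst S T).
Proof. by move=> x; exact: cvg_fst. Qed.

Lemma continuous_snd {S T : topologicalType} : continuous (@snd S T).
Proof. by move=> x; exact: cvg_snd. Qed.

Lemma continuous_comp_total {S T U : topologicalType}
    (f : S -> T) (g : T -> U) :
  continuous f -> continuous g -> continuous (g \o f).
Proof. by move=> cf cg x; apply: continuous_comp; [exact: cf|exact: cg]. Qed.

(** The tube lemma: a point outside the projection has a neighbourhood that
    misses it, because the compact factor is covered by finitely many boxes
    avoiding [C]. Compositions and images of closed relations, as well as the
    relation of a semiflow over a compact set of times, are such projections. *)
Lemma closed_projection {S T : topologicalType} (K : set T) (C : set (T * S)) :
  compact K -> closed C -> closed [set s | exists2 t, K t & C (t, s)].
Proof.
move=> /compact_near_coveringP cK /closed_openC oC.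
rewrite -openC openE => s nCs.
have : \forall s' \near s, K `<=` [set t | ~ C (t, s')].
  apply: (cK _ _ (fun s' t => ~ C (t, s'))) => t Kt.
  have : nbhs (t, s) (~` C).
    by apply: open_nbhs_nbhs; split=> // Cts; apply: nCs; exists t.
  by apply: filterS => -[].
by apply: filterS => s' KC [t /KC].
Qed.

Section ClosedRelations.
Context {X : topologicalType} (compactX : compact [set: X]).
Implicit Types (P Q : set (X * X)) (K : set X).

Lemma closed_compose P Q : closed P -> closed Q -> closed (P \; Q)%relation.
Proof.
move=> cP cQ.
have := @closed_projection (X * X)%type X setT
  [set w | Q (w.2.1, w.1) /\ P (w.1, w.2.2)] compactX.
set C := (X in closed X -> _) => /(_ _)/=.
have cC : closed C.
  apply: closedI.
    apply: (@closed_preimage _ _ (fun w : X * (X * X) => (w.2.1, w.1)) Q) cQ.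
    apply: continuous_pair; last exact: continuous_fst.
    exact: (continuous_comp_total continuous_snd continuous_fst).
  apply: (@closed_preimage _ _ (fun w : X * (X * X) => (w.1, w.2.2)) P) cP.
  apply: continuous_pair; first exact: continuous_fst.
  exact: (continuous_comp_total continuous_snd continuous_snd).
move=> /(_ cC); congr closed; apply/seteqP; split=> -[x z] /=.
  by move=> [y _ []]; exists y.
by move=> [y]; exists y.
Qed.

Lemma closed_inv Q : closed Q -> closed (rel_inv Q).
Proof.
apply: (@closed_preimage _ _ (fun w : X * X => (w.2, w.1))).
exact: continuous_pair continuous_snd continuous_fst.
Qed.

Lemma closed_image Q K : closed Q -> closed K -> closed (rel_image Q K).
Proof.
move=> cQ cK.
have := closed_projection (subclosed_compact cK compactX (@subsetT _ K)) cQ.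
by congr closed; apply/seteqP; split=> y [x].
Qed.

Lemma closed_at Q x : closed Q -> closed (rel_at Q x).
Proof.
apply: (@closed_preimage _ _ (fun y => (x, y))) => y.
by apply: cvg_pair; [exact: cvg_cst|exact: cvg_id].
Qed.

Lemma closed_at_inv Q y : closed Q -> closed [set x | Q (x, y)].
Proof. by move=> /closed_inv /(@closed_at _ y). Qed.

End ClosedRelations.

Section UpperSemicontinuity.
Context {R : realType} {X : metricType R} (compactX : compact [set: X]).

(** Upper semicontinuity of the set-valued map [x |-> Q x]. The points [u']
    that already belong to [Q x] are harmless, and a point [u'] outside [Q x]
    is avoided by [Q x'] for [x'] near [x] because [Q] is closed; compactness
    makes this uniform in [u']. *)
Lemma near_rel_at_mdist (Q : set (X * X)) x (e : R) : closed Q -> 0 < e ->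
  \forall x' \near x, forall u', Q (x', u') ->
    exists2 u, Q (x, u) & mdist u u' < e.
Proof.
move=> /closed_openC oQ e0.
move: (compactX) => /compact_near_coveringP cX.
have : \forall x' \near x, [set: X] `<=`
    [set u' | Q (x', u') -> exists2 u, Q (x, u) & mdist u u' < e].
  apply: (cX _ _ (fun x' u' => Q (x', u') ->
    exists2 u, Q (x, u) & mdist u u' < e)) => u _.
  have [Qxu|nQ] := pselect (Q (x, u)).
    exists (ball u e, setT).
      by split; [exact: nbhsx_ballx|exact: filterT].
    by move=> [u' x'] /= [+ _] _; rewrite ballEmdist /= => ?; exists u.
  have : nbhs (x, u) (~` Q) by exact: open_nbhs_nbhs.
  move=> [[U V] /= [Ux Vu] UV]; exists (V, U) => // -[u' x'] /= [Vu' Ux'] Qxu.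
  by have /= := UV (x', u') (conj Ux' Vu').
by apply: filterS => x' + u'; apply.
Qed.

End UpperSemicontinuity.

(** * The operators G and C *)

Lemma rel_transitiveP {X : Type} (Q : set (X * X)) :
  rel_transitive Q <-> forall x y z, Q (x, y) -> Q (y, z) -> Q (x, z).
Proof.
split=> [tQ x y z Qxy Qyz|tQ [x z] /= [y Qxy Qyz]]; last exact: tQ Qxy Qyz.
by apply: (tQ (x, z)); exists y.
Qed.

Section Orbit.
Context {X : Type}.
Implicit Types (P Q : set (X * X)).

Lemma rel_orbit_sub Q : Q `<=` rel_orbit Q.
Proof. by move=> [x y] Qxy; exists 1%N => //=; exists x. Qed.

Lemma rel_orbit_rcons Q x y z :
  rel_orbit Q (x, y) -> Q (y, z) -> rel_orbit Q (x, z).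
Proof. by move=> [n _ Qxy] Qyz; exists n.+1 => //=; exists y. Qed.

Lemma rel_orbit_last Q x z :
  rel_orbit Q (x, z) -> Q (x, z) \/ exists2 y, rel_orbit Q (x, y) & Q (y, z).
Proof.
move=> [[|[|n]] //= _ [y]]; first by rewrite /rel_diag /= => ->; left.
by move=> Qxy Qyz; right; exists y => //; exists n.+1.
Qed.

Lemma rel_orbit_trans Q : rel_transitive (rel_orbit Q).
Proof.
apply/rel_transitiveP => x y z Qxy [n n1 Qyz]; elim: n n1 z Qyz => // n IH _ z.
move=> /= [w Qyw Qwz]; apply: rel_orbit_rcons Qwz.
case: n => [|n] in IH Qyw *; last exact: IH.
by move: Qyw; rewrite /= /rel_diag /= => <-.
Qed.

Lemma rel_orbit_first Q x z :
  rel_orbit Q (x, z) -> Q (x, z) \/ exists2 y, Q (x, y) & rel_orbit Q (y, z).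
Proof.
move=> [n n1 Qxz]; elim: n n1 z Qxz => // n IH _ z /= [w Qxw Qwz].
case: n => [|n] in IH Qxw *.
  by move: Qxw; rewrite /= /rel_diag /= => ->; left.
right; have [//|//|Qxw'|[y Qxy Qyw]] := IH _ w.
- by exists w => //; exact: rel_orbit_sub.
- by exists y => //; exact: rel_orbit_rcons Qwz.
Qed.

Lemma rel_orbitS P Q : P `<=` Q -> rel_orbit P `<=` rel_orbit Q.
Proof.
move=> PQ [x y] [n n1 Pxy]; exists n => //.
elim: n {n1} y Pxy => //= n IH y [z Pxz Pzy].
by exists z; [exact: IH|exact: PQ].
Qed.

Lemma rel_orbit_min P Q : rel_transitive P -> Q `<=` P -> rel_orbit Q `<=` P.
Proof.
move=> /rel_transitiveP tP QP [x y] [n n1]; elim: n n1 y => // n IH _ y /=.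
move=> [z Qxz /QP Pzy]; case: n => [|n] in IH Qxz *;
  last exact: tP (IH _ _ Qxz) Pzy.
by move: Qxz; rewrite /= /rel_diag /= => ->.
Qed.

End Orbit.

Definition absorbs {X : Type} (S P : set (X * X)) : Prop :=
  (S \; P `<=` P)%relation /\ (P \; S `<=` P)%relation.

Lemma absorbsP {X : Type} (S P : set (X * X)) :
  (forall x y z, S (x, y) -> P (y, z) -> P (x, z)) ->
  (forall x y z, P (x, y) -> S (y, z) -> P (x, z)) -> absorbs S P.
Proof.
move=> SP PS; split=> -[x z] /= [y].
  exact: PS.
exact: SP.
Qed.

Section OperatorG.
Context {X : topologicalType} (compactX : compact [set: X]).
Implicit Types (Q S : set (X * X)).

Lemma rel_G_closed Q : closed (rel_G Q).
Proof. by apply: closed_bigI => P [[]]. Qed.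

Lemma rel_G_trans Q : rel_transitive (rel_G Q).
Proof.
apply/rel_transitiveP => x y z Gxy Gyz P [[cP tP] QP].
apply: (iffLR (rel_transitiveP P) tP x y z).
  by apply: Gxy.
by apply: Gyz.
Qed.

Lemma rel_G_sub Q : Q `<=` rel_G Q.
Proof. exact: sub_smallest. Qed.

Lemma rel_G_min Q P :
  closed P -> rel_transitive P -> Q `<=` P -> rel_G Q `<=` P.
Proof. by move=> cP tP QP; apply: smallest_sub. Qed.

Lemma rel_orbit_G Q : rel_orbit Q `<=` rel_G Q.
Proof. by apply: rel_orbit_min; [exact: rel_G_trans|exact: rel_G_sub]. Qed.

(** The right-hand side is closed by compactness, transitive, and contains
    [Q]; minimality of [rel_G Q] concludes. This isolates an honest [Q]-step at
    the start of a pair of [rel_G Q], although such a pair is not in general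
    given by a finite chain. *)
Lemma rel_G_first Q : closed Q -> rel_G Q `<=` Q `|` (rel_G Q \; Q)%relation.
Proof.
move=> cQ; have /rel_transitiveP tG := @rel_G_trans Q.
have QG := @rel_G_sub Q.
apply: rel_G_min; last by move=> ? ?; left.
  by apply: closedU => //; apply: closed_compose => //; exact: rel_G_closed.
apply/rel_transitiveP => x y z /= Hxy Hyz.
have Gyz : rel_G Q (y, z).
  by case: Hyz => [/QG//|[w /= Qyw Gwz]]; apply: tG Gwz; exact: QG.
right; case: Hxy => [Qxy|[w /= Qxw Gwy]]; first by exists y.
by exists w => //=; apply: tG Gyz.
Qed.

Lemma rel_G_last Q : closed Q -> rel_G Q `<=` Q `|` (Q \; rel_G Q)%relation.
Proof.
move=> cQ; have /rel_transitiveP tG := @rel_G_trans Q.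
have QG := @rel_G_sub Q.
apply: rel_G_min; last by move=> ? ?; left.
  by apply: closedU => //; apply: closed_compose => //; exact: rel_G_closed.
apply/rel_transitiveP => x y z /= Hxy Hyz.
have Gxy : rel_G Q (x, y).
  by case: Hxy => [/QG//|[w /= Qxw Gwy]]; apply: (tG _ w) => //; exact: QG.
right; case: Hyz => [Qyz|[w /= Gyw Qwz]]; first by exists y.
by exists w => //=; apply: tG Gyw.
Qed.

(** The hypotheses let a [Q]-step absorb an adjacent [S]-step, and the two
    decompositions above provide a [Q]-step at each end. *)
Lemma rel_G_absorbs Q S : closed Q ->
  (S \; Q `<=` rel_orbit Q)%relation -> (Q \; S `<=` rel_orbit Q)%relation ->
  absorbs S (rel_G Q).
Proof.
move=> cQ SQ QS; have /rel_transitiveP tG := @rel_G_trans Q.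
have OG := @rel_orbit_G Q.
apply: absorbsP => x y z.
  move=> Sxy /(rel_G_first cQ) [Qyz|[w /= Qyw Gwz]].
    by apply: OG; apply: QS; exists y.
  by apply: tG Gwz; apply: OG; apply: QS; exists y.
move=> /(rel_G_last cQ) [Qxy|[w /= Gxw Qwy]] Syz.
  by apply: OG; apply: SQ; exists y.
by apply: (tG x w) => //; apply: OG; apply: SQ; exists y.
Qed.

End OperatorG.

Section OperatorC.
Context {R : realType} {X : metricType R} (compactX : compact [set: X]).
Implicit Types (Q S : set (X * X)) (e d : R).

Local Notation orb e Q := (rel_orbit (@rel_V R X e \; Q)%relation).

Lemma rel_CP Q x y : rel_C Q (x, y) <-> forall e, 0 < e -> orb e Q (x, y).
Proof. by split=> [C e /C|C e /C]. Qed.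

Lemma rel_VS d e Q : d <= e ->
  ((@rel_V R X d \; Q) `<=` (@rel_V R X e \; Q))%relation.
Proof.
move=> de [x y] [z /= Qxz dzy]; exists z => //=.
exact: lt_le_trans de.
Qed.

Lemma rel_orbit_V_sub Q e : 0 < e -> rel_orbit Q `<=` orb e Q.
Proof.
move=> e0; apply: rel_orbitS => -[x y] Qxy; exists y => //.
by rewrite /rel_V /= mdistxx.
Qed.

(** Each chain ends with a jump, so its end point may be moved at the
    cost of a larger jump. *)
Lemma rel_orbit_V_end Q d d' e x y y' : d + d' <= e -> 0 <= d' ->
  orb d Q (x, y) -> mdist y y' < d' -> orb e Q (x, y').
Proof.
move=> dde d'0 Oxy yy'.
have de : d <= e by lra.
have step z : (@rel_V R X d \; Q)%relation (z, y) ->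
    (@rel_V R X e \; Q)%relation (z, y').
  move=> [w /= Qzw]; rewrite /rel_V /= => wy; exists w => //=.
  apply: le_lt_trans (metric_triangle w y y') _; rewrite /rel_V /=.
  by lra.
have [/step/rel_orbit_sub//|[z Oxz /step zy']] := rel_orbit_last Oxy.
by apply: rel_orbit_rcons zy'; apply: rel_orbitS Oxz; exact: rel_VS.
Qed.

(** The starting point of a chain cannot jump, but by upper semicontinuity
    the first [Q]-step from [x'] can be replaced by one from [x] with a nearby
    target. *)
Lemma near_rel_orbit_V Q e x : closed Q -> 0 < e ->
  \forall x' \near x, forall y, orb (e / 2) Q (x', y) -> orb e Q (x, y).
Proof.
move=> cQ e0; have e20 : 0 < e / 2 by lra.
have := near_rel_at_mdist compactX x cQ e20; apply: filterS => x' near_x y.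
have step z : (@rel_V R X (e / 2) \; Q)%relation (x', z) ->
    (@rel_V R X e \; Q)%relation (x, z).
  move=> [w /= /near_x [u Qxu uw]]; rewrite /rel_V /= => wz; exists u => //=.
  by apply: le_lt_trans (metric_triangle u w z) _; lra.
move=> Ox'y; case: (rel_orbit_first Ox'y) => [/step/rel_orbit_sub//|].
move=> [z /step xz Ozy].
have /rel_transitiveP tO := @rel_orbit_trans _ (@rel_V R X e \; Q)%relation.
apply: tO (rel_orbit_sub xz) _.
by apply: rel_orbitS Ozy; apply: rel_VS; lra.
Qed.

Lemma rel_C_sub Q : rel_orbit Q `<=` rel_C Q.
Proof.
by move=> [x y] Oxy; apply/rel_CP => e e0; exact: rel_orbit_V_sub Oxy.
Qed.

Lemma rel_C_trans Q : rel_transitive (rel_C Q).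
Proof.
apply/rel_transitiveP => x y z /rel_CP Cxy /rel_CP Cyz; apply/rel_CP => e e0.
have /rel_transitiveP tO := @rel_orbit_trans _ (@rel_V R X e \; Q)%relation.
by apply: tO (Cxy _ e0) (Cyz _ e0).
Qed.

Lemma rel_C_closed Q : closed Q -> closed (rel_C Q).
Proof.
move=> cQ [x y] clC; apply/rel_CP => e e0; have e20 : 0 < e / 2 by lra.
have nx := near_rel_orbit_V x cQ e20.
have /(clC _) [[x' y'] [/= /rel_CP Cx'y' [xx' y'y]]] : nbhs (x, y)
  ([set x' | forall y, orb (e / 2 / 2) Q (x', y) -> orb (e / 2) Q (x, y)]
    `*` ball y (e / 2)).
  exists ([set x' | forall y, orb (e / 2 / 2) Q (x', y) ->
    orb (e / 2) Q (x, y)], ball y (e / 2)) => //.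
  by split=> //; exact: nbhsx_ballx.
move: y'y; rewrite ballEmdist /= metric_sym => y'y.
apply: (rel_orbit_V_end _ _ _ y'y); last by apply: xx'; apply: Cx'y'; lra.
  by rewrite -splitr.
by lra.
Qed.

(** An [S]-step before a chain is absorbed by the exact [Q]-step with which the
    chain starts. For an [S]-step after it, a chain from [x] to [y] reaches only
    the vicinity of [y] before its last jump;
    upper semicontinuity of the inverse of [Q] at [y] gives a point [w'], close
    to the last departure point of the chain, with [Q (w', y)] exactly, and
    this last step absorbs [S]. *)
Lemma rel_C_absorbs Q S : closed Q ->
  (S \; Q `<=` rel_orbit Q)%relation -> (Q \; S `<=` rel_orbit Q)%relation ->
  absorbs S (rel_C Q).
Proof.
move=> cQ SQ QS; apply: absorbsP => x y z.
  move=> Sxy /rel_CP Cyz; apply/rel_CP => e e0.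
  have step w : (@rel_V R X e \; Q)%relation (y, w) -> orb e Q (x, w).
    move=> [v /= Qyv vw].
    have Oxv : rel_orbit Q (x, v) by apply: QS; exists y.
    have [Qxv|[u Oxu Quv]] := rel_orbit_last Oxv.
      by apply: rel_orbit_sub; exists v.
    by apply: (@rel_orbit_rcons _ _ _ u); [exact: rel_orbit_V_sub|exists v].
  have /rel_transitiveP tO := @rel_orbit_trans _ (@rel_V R X e \; Q)%relation.
  have [/step//|[w /step Oxw Owz]] := rel_orbit_first (Cyz _ e0).
  exact: tO Owz.
move=> /rel_CP Cxy Syz.
have [Qxy|nQxy] := pselect (Q (x, y)).
  by apply: rel_C_sub; apply: SQ; exists y.
apply/rel_CP => e e0; have e20 : 0 < e / 2 by lra.
have /nbhs_ballP[d1 /= d10 near1] :=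
  near_rel_at_mdist compactX y (closed_inv cQ) e20.
have /nbhs_ballP[d2 /= d20 near2] : \forall y' \near y, ~ Q (x, y').
  have oN : open (~` rel_at Q x) by apply/closed_openC; exact: closed_at.
  by apply: filterS (open_nbhs_nbhs (conj oN nQxy)).
pose d := Num.min d1 (Num.min d2 (e / 2)).
have d0 : 0 < d by rewrite !lt_min d10 d20 e20.
have [dd1 dd2 de] : [/\ d <= d1, d <= d2 & d <= e / 2].
  by rewrite /d !ge_min !lexx !orbT.
(* A chain of length one departs from x itself, which must not be moved; it is
   excluded because Q is closed and does not contain (x, y). *)
have [[y' /= Qxy']|[w Oxw [y' /= Qwy']]] := rel_orbit_last (Cxy _ d0).
  rewrite /rel_V /= metric_sym => yy'; case: (near2 y' _ Qxy').
  by rewrite ballEmdist /=; apply: lt_le_trans dd2.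
rewrite /rel_V /= metric_sym => yy'.
have [|w' /= Qw'y w'w] := near1 y' _ w Qwy'.
  by rewrite ballEmdist /=; apply: lt_le_trans dd1.
have Ow'z : orb e Q (w', z).
  by apply: rel_orbit_V_sub => //; apply: SQ; exists y.
have /rel_transitiveP tO := @rel_orbit_trans _ (@rel_V R X e \; Q)%relation.
apply: tO Ow'z; rewrite metric_sym in w'w.
by apply: (rel_orbit_V_end _ _ Oxw w'w); lra.
Qed.

End OperatorC.

(** * The preorder of a semiflow relation *)

Section Semiflow.
Context {R : realType} {X : metricType R} (Phi : set (X * R * X)).
Hypothesis sPhi : semiflow_relation Phi.

Lemma closed_time_rel_on (K : set R) : compact K -> closed (time_rel_on Phi K).
Proof.
move=> cK; have := @closed_projection (X * X)%type R K
  [set w | Phi (w.2.1, w.1, w.2.2)] cK.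
set C := (X in closed X -> _) => /(_ _)/=.
have cC : closed C.
  apply: (@closed_preimage _ _
    (fun w : R * (X * X) => (w.2.1, w.1, w.2.2)) Phi) (semiflow_closed sPhi).
  have c2 := @continuous_snd R (X * X)%type.
  have c21 := continuous_comp_total c2 (@continuous_fst X X).
  have c22 := continuous_comp_total c2 (@continuous_snd X X).
  exact: continuous_pair (continuous_pair c21 (@continuous_fst _ _)) c22.
exact.
Qed.

Lemma time_relD s t x y z : 0 <= s -> 0 <= t ->
  time_rel Phi s (x, y) -> time_rel Phi t (y, z) -> time_rel Phi (s + t) (x, z).
Proof.
by move=> s0 t0 xy yz; rewrite addrC -(semiflow_comp sPhi t0 s0); exists y.
Qed.

Lemma time_relB s t x z : 0 <= s <= t -> time_rel Phi t (x, z) ->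
  exists2 y, time_rel Phi s (x, y) & time_rel Phi (t - s) (y, z).
Proof.
move=> /andP[s0 st]; rewrite -{1}(subrK s t) -(semiflow_comp sPhi) //.
by lra.
Qed.

Lemma time_rel0 x y : time_rel Phi 0 (x, y) <-> x = y.
Proof. by rewrite (semiflow_id sPhi). Qed.

Lemma phiIP x y :
  phiI Phi (x, y) <-> exists2 t, 0 <= t <= 1 & time_rel Phi t (x, y).
Proof. by split=> -[t]; rewrite /= ?in_itv /=; exists t; rewrite //= in_itv. Qed.

Lemma phiJP x y :
  phiJ Phi (x, y) <-> exists2 t, 1 <= t <= 2 & time_rel Phi t (x, y).
Proof. by split=> -[t]; rewrite /= ?in_itv /=; exists t; rewrite //= in_itv. Qed.

Lemma closed_phiI : closed (phiI Phi).
Proof. exact/closed_time_rel_on/segment_compact. Qed.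

Lemma closed_phiJ : closed (phiJ Phi).
Proof. exact/closed_time_rel_on/segment_compact. Qed.

Lemma time_rel_ge1 t : 1 <= t -> time_rel Phi t `<=` rel_orbit (phiJ Phi).
Proof.
move=> t1 [x z]; have [n] : exists n : nat, t <= n%:R + 1.
  exists (Num.truncn t).+1.
  by rewrite ler_wpDr // ltW // truncnS_gt.
elim: n t t1 z => [|n IH] t t1 z tn xz.
  by apply: rel_orbit_sub; apply/phiJP; exists t => //; lra.
have [t2|t2] := leP t 2.
  by apply: rel_orbit_sub; apply/phiJP; exists t => //; lra.
have [|y xy yz] := @time_relB (t - 1) t x z _ xz; first lra.
rewrite subKr in yz; apply: (@rel_orbit_rcons _ _ _ y).
  by apply: IH xy; rewrite -?natr1 in tn; lra.
by apply/phiJP; exists 1 => //; lra.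
Qed.

Lemma phiI_phiJ : (phiJ Phi \; phiI Phi `<=` rel_orbit (phiJ Phi))%relation.
Proof.
move=> [x z] /= [y /phiIP[s s01 xy] /phiJP[t t12 yz]].
by apply: (@time_rel_ge1 (s + t)); [lra|apply: time_relD xy yz; lra].
Qed.

Lemma phiJ_phiI : (phiI Phi \; phiJ Phi `<=` rel_orbit (phiJ Phi))%relation.
Proof.
move=> [x z] /= [y /phiJP[s s01 xy] /phiIP[t t12 yz]].
by apply: (@time_rel_ge1 (s + t)); [lra|apply: time_relD xy yz; lra].
Qed.

Lemma phiI_phiI :
  (phiI Phi \; phiI Phi `<=` phiI Phi `|` rel_orbit (phiJ Phi))%relation.
Proof.
move=> [x z] /= [y /phiIP[s s01 xy] /phiIP[t t12 yz]].
have xz : time_rel Phi (s + t) (x, z) by apply: time_relD xy yz; lra.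
have [st|st] := leP (s + t) 1.
  by left; apply/phiIP; exists (s + t) => //; lra.
by right; apply: time_rel_ge1 xz; lra.
Qed.

(** Going around the loop [y -> x -> y] takes a positive time, because time
    zero only relates a point to itself; enough turns make the total time from
    [y] to [x] at least one. *)
Lemma phiI_cycle x y : x <> y -> phiI Phi (x, y) -> phiI Phi (y, x) ->
  rel_orbit (phiJ Phi) (y, x).
Proof.
move=> xy /phiIP[s s01 Fxy] /phiIP[t t01 Fyx].
have st0 : 0 < s + t.
  rewrite lt_neqAle eq_sym; apply/andP; split; last lra.
  apply/eqP => st; have s0 : s = 0 by lra.
  by apply: xy; apply/time_rel0; rewrite -s0.
have loop n : time_rel Phi (t + n%:R * (s + t)) (y, x).
  elim: n => [|n IH]; first by rewrite mul0r addr0.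
  have -> : t + n.+1%:R * (s + t) = t + n%:R * (s + t) + (s + t).
    by rewrite -natr1; lra.
  apply: time_relD IH _; last by apply: time_relD Fxy Fyx; lra.
    by rewrite addr_ge0 ?mulr_ge0 //; lra.
  by lra.
apply: time_rel_ge1 (loop (Num.truncn (s + t)^-1).+1).
have : 1 <= (Num.truncn (s + t)^-1).+1%:R * (s + t).
  by rewrite -ler_pdivrMr // div1r ltW // truncnS_gt.
by lra.
Qed.

Variable P : set (X * X).
Hypotheses (cP : closed P) (tP : rel_transitive P).
Hypotheses (JP : rel_orbit (phiJ Phi) `<=` P) (aP : absorbs (phiI Phi) P).
Let F := phiI Phi `|` P.

Lemma phiI_P x y z : phiI Phi (x, y) -> P (y, z) -> P (x, z).
Proof. by move=> xy yz; apply: (aP.2 (x, z)); exists y. Qed.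

Lemma P_phiI x y z : P (x, y) -> phiI Phi (y, z) -> P (x, z).
Proof. by move=> xy yz; apply: (aP.1 (x, z)); exists y. Qed.

Lemma closed_phiIU : closed F.
Proof. by apply: closedU => //; exact: closed_phiI. Qed.

Lemma phiIU_refl x : F (x, x).
Proof. by left; apply/phiIP; exists 0; [lra|exact/time_rel0]. Qed.

Lemma phiIU_trans x y z : F (x, y) -> F (y, z) -> F (x, z).
Proof.
have /rel_transitiveP tP' := tP.
move=> [xy|xy] [yz|yz].
- have [xz|/JP xz] : (phiI Phi `|` rel_orbit (phiJ Phi)) (x, z).
  + by apply: phiI_phiI; exists y.
  + by left.
  + by right.
- by right; apply: phiI_P yz.
- by right; apply: P_phiI yz.
- by right; apply: tP' yz.
Qed.

Lemma phiIU_sym x y : x <> y -> F (x, y) -> F (y, x) -> P (y, x).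
Proof.
move=> xy Fxy [yx|//]; case: Fxy => [Sxy|Pxy].
  by apply: JP; exact: phiI_cycle Sxy yx.
exact: phiI_P yx (P_phiI Pxy yx).
Qed.

End Semiflow.

(** * Monotone Urysohn functions for a closed preorder *)

Section MonotoneUrysohn.
Context {R : realType} {X : topologicalType}.
Hypotheses (compactX : compact [set: X]) (hausdorffX : hausdorff_space X).
Variable F : set (X * X).
Hypotheses (cF : closed F) (rF : forall x, F (x, x)).
Hypothesis tF : forall x y z, F (x, y) -> F (y, z) -> F (x, z).
Implicit Types P Q : set X.

(** An asymmetric proximity: it plays the role of the inclusion
    [closure P `<=` interior Q] of the usual construction of Urysohn functions,
    and coincides with it when [F] is equality. *)
Definition well_below P Q :=
  forall p q, closure P p -> closure (~` Q) q -> ~ F (q, p).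

Lemma well_below_sub P Q : well_below P Q -> P `<=` Q.
Proof.
move=> PQ x Px; apply: contrapT => nQx.
by apply: (PQ x x) (rF x); exact: subset_closure.
Qed.

(** [K], the past of [closure P], and [H], the future of [closure (~` Q)], are
    disjoint by transitivity. Both [well_below] conditions on [M] only involve
    [K] and [H], so the normality of the space suffices and [M] is not required
    to be monotone. *)
Lemma well_below_interpolate P Q :
  well_below P Q -> exists2 M, well_below P M & well_below M Q.
Proof.
move=> PQ.
pose K := rel_image (rel_inv F) (closure P).
pose H := rel_image F (closure (~` Q)).
have cK : closed K.
  by apply: closed_image => //; [exact: closed_inv|exact: closed_closure].
have cH : closed H by apply: closed_image => //; exact: closed_closure.
have KH0 : K `&` H = set0.
  rewrite -subset0 => z [[p clPp Fzp] [q clQq Fqz]].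
  exact: (PQ p q clPp clQq (tF Fqz Fzp)).
have /(@normal_openP R)/(_ K H cK cH KH0)[U [V [oU oV KU HV UV0]]] :=
  compact_normal hausdorffX compactX.
exists U => p q clp clq Fqp.
  have : (~` U) q.
    by move: clq; rewrite -(iffLR (closure_id _)) //; exact: open_closedC.
  by apply; apply: KU; exists p.
have Vp : V p by apply: HV; exists q.
have [z] := clp V (open_nbhs_nbhs (conj oV Vp)).
by rewrite UV0.
Qed.

Variables A B : set X.
Hypothesis AB : well_below B (~` A).

Let mid P Q : set X :=
  xget set0 [set M | well_below P Q -> well_below P M /\ well_below M Q].

Let midP P Q :
  well_below P Q -> well_below P (mid P Q) /\ well_below (mid P Q) Q.
Proof.
move=> PQ; rewrite /mid; case: xgetP => [M _ /(_ PQ)//|none].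
have [M PM MQ] := well_below_interpolate PQ.
by case: (none M).
Qed.

Let level0 k := if k is k'.+1 then if k' is 0 then ~` A else setT else B.

(** [level n k] is the sublevel set attached to the dyadic number [k / 2 ^ n];
    it is everything as soon as this number is at least 2. *)
Fixpoint level n k : set X :=
  if n is m.+1 then
    if odd k then mid (level m k./2) (level m k./2.+1) else level m k./2
  else level0 k.

Lemma level_well_below n k : well_below (level n k) (level n k.+1).
Proof.
elim: n k => [|n IH] k /=.
  by case: k => [|[|k]] //= p q _; rewrite setCT closure0.
have [ok|ek] := boolP (odd k); rewrite /=.
  have -> : uphalf k = k./2.+1 by rewrite uphalf_half ok.
  by have [] := midP (IH k./2).
have -> : uphalf k = k./2 by rewrite uphalf_half (negbTE ek).
by have [] := midP (IH k./2).
Qed.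

Lemma level_mono n k l : (k <= l)%N -> level n k `<=` level n l.
Proof.
move=> /subnKC <-; elim: (l - k)%N => [|m IH]; first by rewrite addn0.
rewrite addnS; apply: subset_trans IH _.
exact: well_below_sub (@level_well_below _ _).
Qed.

Lemma level_refine n m k : level (m + n) (k * 2 ^ m) = level n k.
Proof.
elim: m k => [|m IH] k; first by rewrite add0n muln1.
rewrite addSn /= expnS mulnCA mul2n odd_double doubleK.
exact: IH.
Qed.

Let dyadic n k : R := k%:R / 2 ^+ n.

Lemma dyadic_le n k m l : dyadic n k <= dyadic m l -> level n k `<=` level m l.
Proof.
rewrite /dyadic ler_pdivrMr ?exprn_gt0// mulrAC ler_pdivlMr ?exprn_gt0//.
rewrite -!natrX -!natrM ler_nat => kl.
rewrite -(level_refine n m k) -(level_refine m n l) addnC.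
exact: level_mono.
Qed.

Lemma dyadic_dense (a b : R) : 0 <= a -> a < b ->
  exists n k, a < dyadic n k /\ dyadic n k.+1 < b.
Proof.
move=> a0 ab.
have [n nab] : exists n : nat, 2 / (b - a) < 2 ^+ n.
  exists (Num.truncn (2 / (b - a))).+1.
  apply: lt_trans (truncnS_gt _) _; rewrite -natrX ltr_nat.
  exact: ltn_expl.
have n0 : 0 < 2 ^+ n :> R by rewrite exprn_gt0.
have an0 : 0 <= a * 2 ^+ n by rewrite mulr_ge0 // ltW.
exists n, (Num.truncn (a * 2 ^+ n)).+1; rewrite /dyadic.
split; first by rewrite ltr_pdivlMr // truncnS_gt.
rewrite ltr_pdivrMr // -natr1 -natr1.
move: nab; rewrite ltr_pdivrMr ?subr_gt0 // => nab.
have : (Num.truncn (a * 2 ^+ n))%:R <= a * 2 ^+ n by rewrite truncn_le.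
by rewrite mulrBr in nab; lra.
Qed.

Let values x : set R := [set r | exists n k, level n k x /\ r = dyadic n k].

Let level_inf x := inf (values x).

Let values_inf x : has_inf (values x).
Proof.
split; first by exists (dyadic 0 2); exists 0%N, 2%N.
by exists 0 => _ [n [k [_ ->]]]; rewrite divr_ge0.
Qed.

Lemma level_inf_ge0 x : 0 <= level_inf x.
Proof.
apply: (lb_le_inf (values_inf x).1) => _ [n [k [_ ->]]].
by rewrite divr_ge0.
Qed.

Lemma level_inf_le n k x : level n k x -> level_inf x <= dyadic n k.
Proof. by move=> xn; apply: (ge_inf (values_inf x).2); exists n, k. Qed.

Lemma level_inf_ge n k x : ~ level n k x -> dyadic n k <= level_inf x.
Proof.
move=> xn; apply: (lb_le_inf (values_inf x).1) => _ [m [l [xm ->]]].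
by rewrite leNgt; apply/negP => /ltW/dyadic_le/(_ _ xm).
Qed.

(** A strict decrease would leave room for two consecutive dyadic levels, the
    lower one containing [y] and the upper one missing [x]. *)
Lemma level_inf_mono x y : F (x, y) -> level_inf x <= level_inf y.
Proof.
move=> Fxy; rewrite leNgt; apply/negP => yx.
have [n [k [yk kx]]] := dyadic_dense (level_inf_ge0 y) yx.
apply: (@level_well_below n k y x _ _ Fxy); apply: subset_closure.
  by apply: contrapT => /level_inf_ge; lra.
by move=> /level_inf_le; lra.
Qed.

Lemma level_inf_continuous : continuous (level_inf : X -> R^o).
Proof.
move=> x; apply/cvgrPdist_lt => e e0.
have [n [k [xk ke]]] : exists n k,
    level_inf x < dyadic n k /\ dyadic n k.+1 < level_inf x + e.
  by apply: dyadic_dense (level_inf_ge0 x) _; lra.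
have near_lt : \forall y \near x, level_inf y < level_inf x + e.
  have : nbhs x (~` closure (~` level n k.+1)).
    apply: open_nbhs_nbhs; split; first exact/closed_openC/closed_closure.
    move=> cx; apply: (@level_well_below n k x x _ cx (rF x)).
    by apply: subset_closure; apply: contrapT => /level_inf_ge; lra.
  apply: filterS => y ny; have : level n k.+1 y.
    by apply: contrapT => nl; apply: ny; exact: subset_closure.
  by move=> /level_inf_le; lra.
have near_gt : \forall y \near x, level_inf x - e < level_inf y.
  have [xe|xe] := ltP (level_inf x - e) 0.
    by apply: nearW => y; have := level_inf_ge0 y; lra.
  have [m [l [xl lx]]] : exists n k,
      level_inf x - e < dyadic n k /\ dyadic n k.+1 < level_inf x.
    by apply: dyadic_dense => //; lra.
  have : nbhs x (~` closure (level m l)).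
    apply: open_nbhs_nbhs; split; first exact/closed_openC/closed_closure.
    move=> cx; apply: (@level_well_below m l x x cx _ (rF x)).
    by apply: subset_closure => /level_inf_le; lra.
  apply: filterS => y ny; have : ~ level m l y.
    by move=> nl; apply: ny; exact: subset_closure.
  by move=> /level_inf_ge; lra.
near=> y; rewrite ltr_distlC; apply/andP; split; first by near: y.
by near: y.
Unshelve. all: by end_near. Qed.

Lemma monotone_separation : exists f : X -> R,
  [/\ continuous f, forall x, 0 <= f x <= 1,
      forall x y, F (x, y) -> f x <= f y,
      forall x, B x -> f x = 0 & forall x, A x -> f x = 1].
Proof.
exists (level_inf \min cst 1); split.
- move=> x; apply: continuous_min; first exact: level_inf_continuous.
  exact: cst_continuous.
- by move=> x /=; rewrite le_min level_inf_ge0 ler01 ge_min lexx orbT.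
- by move=> x y /level_inf_mono xy /=; rewrite le_min !ge_min xy lexx orbT.
- move=> x Bx /=; have := @level_inf_le 0 0 x Bx; rewrite /dyadic mul0r => gx.
  have -> : level_inf x = 0 by apply/eqP; rewrite eq_le gx level_inf_ge0.
  by rewrite min_l.
- move=> x Ax /=; have := @level_inf_ge 0 1 x (fun nA => nA Ax).
  by rewrite /dyadic mul1r expr0 invr1 => gx; rewrite min_r.
Qed.

End MonotoneUrysohn.

(** * Countable subfamilies and weighted means *)

(** The Lindelof property, for countably many families with a common index
    set: for each basic open set and each [j], one member of the [j]-th family
    containing that basic set is kept, if there is one. *)
Lemma countable_subfamilies {R : realType} {T : pseudoMetricType R}
    (J : countType) (I : Type) (O : J -> I -> set T) (i0 : I) :
  compact [set: T] -> (forall j i, open (O j i)) ->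
  exists u : nat -> I, forall j i, O j i `<=` \bigcup_n O j (u n).
Proof.
move=> cT oO; have [[t0 _]|T0] := pselect (exists t : T, True); last first.
  by exists (fun=> i0) => j i t; case: T0; exists t.
pose T' : pseudoPMetricType R := HB.pack T (isPointed.Build T t0).
have [B cB [_ basisB]] := @compact_second_countable R T' cT.
have [f fB] : exists f : nat -> set T, B `<=` range f.
  move: cB => /pfcard_geP[->|[f]]; first by exists (fun=> set0).
  by exists f => b /(@surj _ _ _ _ f) [n _ <-]; exists n.
have /choice[v vP] : forall kj : nat * J, exists i,
    forall i', f kj.1 `<=` O kj.2 i' -> f kj.1 `<=` O kj.2 i.
  move=> [k j] /=; have [[i ki]|none] := pselect (exists i, f k `<=` O j i).
    by exists i.
  by exists i0 => i' ki'; case: none; exists i'.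
exists (fun n => if unpickle n is Some kj then v kj else i0) => j i t Oit.
have [V [BV Vt] VO] : filter_from [set U | B U /\ U t] id (O j i).
  by apply: basisB; apply: open_nbhs_nbhs.
have [k _ fk] := fB V BV.
exists (pickle (k, j)) => //; rewrite pickleK.
by apply: (vP (k, j) i); rewrite /= fk.
Qed.

Section DyadicAverage.
Context {R : realType}.
Implicit Types a b : nat -> R.

Let s a : R^nat := series (fun n => a n / 2 ^+ n.+1).

(** A weighted mean with positive weights of total mass one: it keeps the unit
    interval stable and is strictly monotone in each term. *)
Definition dyadic_average a : R := limn (s a).

Let sS a n : s a n.+1 = s a n + a n / 2 ^+ n.+1.
Proof. exact: seriesSr. Qed.

Let s0 a : s a 0%N = 0.
Proof. by rewrite /s /series /= big_geq. Qed.

Let weight_le (r t : R) n : r <= t -> r / 2 ^+ n.+1 <= t / 2 ^+ n.+1.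
Proof. by move=> rt; rewrite ler_pM2r // invr_gt0 exprn_gt0. Qed.

Section UnitInterval.
Variable a : nat -> R.
Hypothesis a01 : forall n, 0 <= a n <= 1.

Let s_nd : nondecreasing_seq (s a).
Proof.
apply/nondecreasing_seqP => n; rewrite sS lerDl.
by rewrite divr_ge0 //; have /andP[] := a01 n.
Qed.

Let s_tail m n : (m <= n)%N -> s a n - s a m <= 2 ^- m - 2 ^- n.
Proof.
move=> /subnKC <-; elim: (n - m)%N => [|k IH]; first by rewrite addn0 !subrr.
rewrite addnS sS.
have /andP[_ /(@weight_le _ _ (m + k))] := a01 (m + k).
have e2 : 2 ^- (m + k) = 2 * 2 ^- (m + k).+1 :> R.
  by rewrite exprS invfM mulrA divff // mul1r.
rewrite e2 in IH; move: IH; rewrite div1r.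
set v := s a (m + k); set w := s a m; lra.
Qed.

Lemma cvg_dyadic_average : cvgn (s a).
Proof.
apply: nondecreasing_is_cvgn s_nd _; exists 1 => _ [n _ <-].
have := @s_tail 0 n (leq0n _).
rewrite expr0 invr1 s0 subr0 => /le_trans; apply.
by rewrite gerBl invr_ge0 exprn_ge0.
Qed.

Lemma dyadic_average_ge n : s a n <= dyadic_average a.
Proof. exact: nondecreasing_cvgn_le s_nd cvg_dyadic_average n. Qed.

Lemma dyadic_average_le n : dyadic_average a <= s a n + 2 ^- n.
Proof.
apply: limr_le; first exact: cvg_dyadic_average.
near=> m; have nm : (n <= m)%N by near: m; exact: nbhs_infty_ge.
have := s_tail nm; have : 0 <= 2 ^- m :> R by rewrite invr_ge0 exprn_ge0.
by lra.
Unshelve. all: by end_near. Qed.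

Lemma dyadic_average_itv : 0 <= dyadic_average a <= 1.
Proof.
have := dyadic_average_ge 0; have := dyadic_average_le 0.
by rewrite s0 expr0 invr1 add0r => -> ->.
Qed.

End UnitInterval.

Section Monotone.
Variables a b : nat -> R.
Hypotheses (a01 : forall n, 0 <= a n <= 1) (b01 : forall n, 0 <= b n <= 1).
Hypothesis ab : forall n, a n <= b n.

Lemma dyadic_average_mono : dyadic_average a <= dyadic_average b.
Proof.
apply: lim_series_le => [||n]; [exact: cvg_dyadic_average..|].
exact: weight_le.
Qed.

Lemma dyadic_average_mono_lt n :
  a n < b n -> dyadic_average a < dyadic_average b.
Proof.
move=> abn; pose d := b n / 2 ^+ n.+1 - a n / 2 ^+ n.+1.
have d0 : 0 < d by rewrite subr_gt0 ltr_pM2r ?invr_gt0 ?exprn_gt0.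
have sd k : s a (n.+1 + k)%N + d <= s b (n.+1 + k)%N.
  elim: k => [|k IH].
    have sn : s a n <= s b n.
      by rewrite /s /series /=; apply: ler_sum => i _; exact: weight_le.
    by rewrite addn0 !sS -addrA [_ / _ + _]addrC subrK lerD2r.
  rewrite addnS (sS a (n.+1 + k)) (sS b (n.+1 + k)) addrAC.
  by apply: lerD IH _; exact: weight_le.
apply: (@lt_le_trans _ _ (dyadic_average a + d)); first by rewrite ltrDl.
rewrite -lerBrDr; apply: limr_le; first exact: cvg_dyadic_average.
near=> m; have nm : (n < m)%N by near: m; exact: nbhs_infty_ge.
have := sd (m - n.+1)%N; rewrite subnKC // => h.
by have := dyadic_average_ge b01 m; lra.
Unshelve. all: by end_near. Qed.

End Monotone.

Lemma dyadic_average0 : dyadic_average (fun=> 0) = 0.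
Proof.
rewrite /dyadic_average.
have -> : s (fun=> 0) = cst 0; last exact: lim_cst.
by apply/funext => n; rewrite /s /series /= big1 // => k _; rewrite mul0r.
Qed.

Lemma dyadic_average1 : dyadic_average (fun=> 1) = 1.
Proof.
apply: cvg_lim => //.
have -> : s (fun=> 1) = series (geometric (1 / 2) (1 / 2)).
  apply/funext => n; rewrite /s /series /=; apply: eq_bigr => k _.
  by rewrite expr_div_n expr1n exprS !div1r invfM.
have := @cvg_geometric_series R (1 / 2) (1 / 2).
have -> : 1 / 2 * (1 - 1 / 2)^-1 = 1 :> R by field.
by apply; rewrite ger0_norm; lra.
Qed.

Lemma dyadic_average_continuous (T : topologicalType) (f : nat -> T -> R) :
  (forall n, continuous (f n)) -> (forall n x, 0 <= f n x <= 1) ->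
  continuous (fun x => dyadic_average (f ^~ x)).
Proof.
move=> cf f01.
have s_continuous n : continuous (fun x => s (f ^~ x) n : R^o).
  elim: n => [|n IH] x.
    have -> : (fun x => s (f ^~ x) 0%N) = cst 0 by apply/funext => y; rewrite s0.
    exact: cst_continuous.
  have -> : (fun x => s (f ^~ x) n.+1) =
      (fun x => s (f ^~ x) n + f n x / 2 ^+ n.+1).
    by apply/funext => y; rewrite sS.
  have cfn : {for x, continuous (fun y => f n y / 2 ^+ n.+1 : R^o)}.
    by apply: (@continuousM R T); [exact: cf|exact: cst_continuous].
  exact: cvgD (IH x) cfn.
move=> x; apply/(@cvgrPdist_lt R R^o) => e e0.
have e30 : 0 < e / 3 by lra.
have [n ne] : exists n : nat, 2 ^- n < e / 3.
  exists (Num.truncn (e / 3)^-1).+1.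
  rewrite -[ltRHS]invrK ltf_pV2 ?posrE ?exprn_gt0 ?invr_gt0 //.
  apply: lt_trans (truncnS_gt _) _; rewrite -natrX ltr_nat.
  exact: ltn_expl.
have := s_continuous n x; move/cvgrPdist_lt => /(_ _ e30); apply: filterS => y.
rewrite !ltr_distlC => /andP[h1 h2].
have := dyadic_average_ge (f01 ^~ x) n; have := dyadic_average_le (f01 ^~ x) n.
have := dyadic_average_ge (f01 ^~ y) n; have := dyadic_average_le (f01 ^~ y) n.
by move=> *; apply/andP; split; lra.
Qed.

End DyadicAverage.

(** * Strict Lyapunov functions *)

Section StrictMonotone.
Context {R : realType} {X : metricType R} (compactX : compact [set: X]).
Variable F : set (X * X).
Hypotheses (cF : closed F) (rF : forall x, F (x, x)).
Hypothesis tF : forall x y z, F (x, y) -> F (y, z) -> F (x, z).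

Definition separates (A B : set X) (f : X -> R) : Prop :=
  [/\ continuous f, forall x, 0 <= f x <= 1,
      forall x y, F (x, y) -> f x <= f y,
      forall x, B x -> f x = 0 & forall x, A x -> f x = 1].

Definition up_closed (A : set X) := forall x y, A x -> F (x, y) -> A y.
Definition down_closed (B : set X) := forall x y, B y -> F (x, y) -> B x.

Lemma separatesS A B A' B' f : A `<=` A' -> B `<=` B' ->
  separates A' B' f -> separates A B f.
Proof.
move=> AA' BB' [cf f01 fm fB fA].
by split=> // z; [move=> /BB'; exact: fB|move=> /AA'; exact: fA].
Qed.

Lemma separates_exists A B : closed A -> closed B -> A `&` B = set0 ->
  up_closed A -> exists f, separates A B f.
Proof.
move=> cA cB AB0 upA.
apply: (monotone_separation compactX (@metric_hausdorff _ X) cF rF tF) => p q.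
rewrite setCK -!(iffLR (closure_id _)) // => Bp Aq Fqp.
have : (A `&` B) p by split=> //; exact: upA Fqp.
by rewrite AB0.
Qed.

Lemma up_closed_at x : up_closed (rel_at F x).
Proof. by move=> y z; exact: tF. Qed.

(** The future of [y] may be added to [A] and the past of [x] to [B] without
    destroying disjointness; this is where each hypothesis on [x] and [y] is
    spent. *)
Lemma separates_points A B x y : closed A -> closed B -> A `&` B = set0 ->
  up_closed A -> down_closed B -> ~ A x -> ~ B y -> ~ F (y, x) ->
  exists2 f, separates A B f & f x = 0 /\ f y = 1.
Proof.
move=> cA cB AB0 upA downB nAx nBy nFyx.
have [f sf] : exists f,
    separates (A `|` rel_at F y) (B `|` [set z | F (z, x)]) f.
  apply: separates_exists.
  - by apply: closedU => //; exact: closed_at.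
  - by apply: closedU => //; exact: closed_at_inv.
  - rewrite -subset0 => z [[Az|Fyz] [Bz|Fzx]].
    + by rewrite -AB0.
    + exact: nAx (upA _ _ Az Fzx).
    + exact: nBy (downB _ _ Bz Fyz).
    + exact: nFyx (tF Fyz Fzx).
  - move=> z w [Az|Fyz] Fzw; first by left; exact: upA Fzw.
    by right; exact: up_closed_at Fzw.
exists f; first exact: separatesS sf.
have [_ _ _ fB fA] := sf.
by split; [apply: fB; right; exact: rF|apply: fA; right; exact: rF].
Qed.

Lemma open_lt_fun (T : topologicalType) (f g : T -> R) :
  continuous f -> continuous g -> open [set t | f t < g t].
Proof.
move=> cf cg.
have -> : [set t | f t < g t] = (fun t => g t - f t) @^-1` [set r | 0 < r].
  by apply/seteqP; split=> t /=; rewrite subr_gt0.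
apply: open_comp; last exact: open_gt.
by move=> t _; exact: (@continuousB _ R^o _ _ _ _ (cg t) (cf t)).
Qed.

(** The function is a weighted mean of countably many separating functions.
    Each of the three kinds of strict inequality to be achieved holds for some
    separating function and is an open condition on a pair of points, so that
    countably many separating functions are enough to witness all of them, and
    strictness for one of them passes to the mean. *)
Lemma strict_lyapunov A B : closed A -> closed B -> A `&` B = set0 ->
  up_closed A -> down_closed B ->
  exists2 L, separates A B L &
    [/\ B = L @^-1` [set 0], A = L @^-1` [set 1] &
      forall x y, F (x, y) -> L x = L y ->
        [\/ A x /\ A y, B x /\ B y | F (y, x)]].
Proof.
move=> cA cB AB0 upA downB.
pose I := {f : X -> R | separates A B f}.
have [f0 sf0] := separates_exists cA cB AB0 upA.
pose O (j : option bool) (i : I) : set (X * X) :=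
  match j with
  | None => [set xy | sval i xy.1 < sval i xy.2]
  | Some false => [set xy | 0 < sval i xy.1]
  | Some true => [set xy | sval i xy.1 < 1]
  end.
have oO j i : open (O j i).
  have [cf _ _ _ _] := svalP i.
  have c1 := continuous_comp_total (@continuous_fst X X) cf.
  have c2 := continuous_comp_total (@continuous_snd X X) cf.
  by case: j => [[]|]; apply: open_lt_fun => //; exact: cst_continuous.
have cXX : compact [set: X * X].
  by rewrite -setXTT; exact: compact_setX.
have [u uO] := countable_subfamilies (exist _ f0 sf0 : I) cXX oO.
pose f n := sval (u n).
have cf n : continuous (f n) by have [] := svalP (u n).
have f01 n x : 0 <= f n x <= 1.
  by have [_ h _ _ _] := svalP (u n); exact: h.
have fm n x y : F (x, y) -> f n x <= f n y.
  by have [_ _ h _ _] := svalP (u n); exact: h.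
have fB x : B x -> f ^~ x = fun=> 0.
  by move=> Bx; apply/funext => n; have [_ _ _ h _] := svalP (u n); exact: h.
have fA x : A x -> f ^~ x = fun=> 1.
  by move=> Ax; apply/funext => n; have [_ _ _ _ h] := svalP (u n); exact: h.
pose L x := dyadic_average (f ^~ x).
have LB x : B x -> L x = 0 by rewrite /L => /fB ->; exact: dyadic_average0.
have LA x : A x -> L x = 1 by rewrite /L => /fA ->; exact: dyadic_average1.
exists L; split=> //.
- exact: dyadic_average_continuous.
- by move=> x; exact: dyadic_average_itv.
- by move=> x y Fxy; apply: dyadic_average_mono => // n; exact: fm.
- apply/seteqP; split=> x /=; first exact: LB.
  move=> Lx0; apply: contrapT => nBx.
  have [g sg gx] : exists2 g, separates A B g & g x = 1.
    have [g sg] : exists g, separates (A `|` rel_at F x) B g.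
      apply: separates_exists => //.
      - by apply: closedU => //; exact: closed_at.
      - rewrite -subset0 => z [[Az|Fxz] Bz]; first by rewrite -AB0.
        exact: nBx (downB _ _ Bz Fxz).
      - move=> z w [Az|Fxz] Fzw; first by left; exact: upA Fzw.
        by right; exact: up_closed_at Fzw.
    exists g; first exact: separatesS sg.
    by have [_ _ _ _ gA] := sg; apply: gA; right; exact: rF.
  have [|n _ /= fn] := uO (Some false) (exist _ g sg) (x, x).
    by rewrite /O /= gx.
  suff : 0 < L x by rewrite Lx0 ltxx.
  rewrite -(@dyadic_average0 R).
  apply: (@dyadic_average_mono_lt _ _ _ _ _ _ n) => //.
  + by move=> k; rewrite lexx ler01.
  + by move=> k; have /andP[] := f01 k x.
- apply/seteqP; split=> x /=; first exact: LA.
  move=> Lx1; apply: contrapT => nAx.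
  have [g sg gx] : exists2 g, separates A B g & g x = 0.
    have [g sg] : exists g, separates A (B `|` [set z | F (z, x)]) g.
      apply: separates_exists => //.
      - by apply: closedU => //; exact: closed_at_inv.
      - rewrite -subset0 => z [Az [Bz|Fzx]]; first by rewrite -AB0.
        exact: nAx (upA _ _ Az Fzx).
    exists g; first exact: separatesS sg.
    by have [_ _ _ gB _] := sg; apply: gB; right; exact: rF.
  have [|n _ /= fn] := uO (Some true) (exist _ g sg) (x, x).
    by rewrite /O /= gx.
  suff : L x < 1 by rewrite Lx1 ltxx.
  rewrite -(@dyadic_average1 R).
  apply: (@dyadic_average_mono_lt _ _ _ _ _ _ n) => //.
  + by move=> k; rewrite lexx ler01.
  + by move=> k; have /andP[] := f01 k x.
- move=> x y Fxy Lxy.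
  have [Ax|nAx] := pselect (A x).
    by apply: Or31; split=> //; exact: upA Fxy.
  have [By|nBy] := pselect (B y).
    by apply: Or32; split=> //; exact: downB Fxy.
  apply: Or33; apply: contrapT => nFyx.
  have [g sg [gx gy]] := separates_points cA cB AB0 upA downB nAx nBy nFyx.
  have [|n _ /= fn] := uO None (exist _ g sg) (x, y).
    by rewrite /O /= gx gy.
  suff : L x < L y by rewrite Lxy ltxx.
  by apply: (@dyadic_average_mono_lt _ _ _ _ _ _ n) => // k; exact: fm.
Qed.

End StrictMonotone.

(** * Critical points *)

Section CriticalSet.
Context {R : realType} {X : topologicalType} (compactX : compact [set: X]).
Variables (P : set (X * X)) (L : X -> R).
Hypotheses (cP : closed P) (cL : continuous L).

Lemma cyclic_critical : cyclic_set P `<=` critical_set P L.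
Proof.
move=> x Pxx [supL _]; move: supL; rewrite ltNge => /negP; apply.
by apply: ereal_sup_ubound; exists x.
Qed.

(** By compactness the supremum and the infimum in the definition of a
    critical point are attained, unless the sets are empty. *)
Lemma noncritical x : (forall y, P (x, y) -> L x < L y) ->
  (forall y, P (y, x) -> L y < L x) -> ~ critical_set P L x.
Proof.
move=> xlt ltx; apply; split.
  have [->|/set0P P0] := eqVneq (rel_at (rel_inv P) x) set0.
    by rewrite image_set0 ereal_sup0 ltNyr.
  have cPx : compact (rel_at (rel_inv P) x).
    apply: (subclosed_compact _ compactX) => //.
    by apply: closed_at; exact: closed_inv.
  have [c /set_mem Pcx cmax] :=
    compact_EVT_max P0 cPx (continuous_subspaceT cL).
  apply: (@le_lt_trans _ _ (L c)%:E); last by rewrite lte_fin; exact: ltx.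
  apply: ge_ereal_sup => _ [y Pyx <-].
  by rewrite lee_fin; apply: cmax; rewrite inE.
have [->|/set0P P0] := eqVneq (rel_at P x) set0.
  by rewrite image_set0 ereal_inf0 ltry.
have cPx : compact (rel_at P x).
  by apply: (subclosed_compact _ compactX) => //; exact: closed_at.
have [c /set_mem Pxc cmin] := compact_EVT_min P0 cPx (continuous_subspaceT cL).
apply: (@lt_le_trans _ _ (L c)%:E); first by rewrite lte_fin; exact: xlt.
apply: le_ereal_inf_tmp => _ [y Pxy <-].
by rewrite lee_fin; apply: cmin; rewrite inE.
Qed.

End CriticalSet.

(** * Lyapunov functions for semiflow relations *)

(** The only properties of the operators [rel_G] and [rel_C] from which the
    theorem follows. *)
Lemma operator_props {R : realType} {X : metricType R}
    (compactX : compact [set: X]) (calA : set (X * X) -> set (X * X))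
    (Q S : set (X * X)) :
  calA = rel_G \/ calA = rel_C -> closed Q ->
  (S \; Q `<=` rel_orbit Q)%relation -> (Q \; S `<=` rel_orbit Q)%relation ->
  [/\ closed (calA Q), rel_transitive (calA Q), rel_orbit Q `<=` calA Q &
      absorbs S (calA Q)].
Proof.
move=> [] -> cQ SQ QS; split.
- exact: rel_G_closed.
- exact: rel_G_trans.
- exact: rel_orbit_G.
- exact: rel_G_absorbs.
- exact: rel_C_closed.
- exact: rel_C_trans.
- exact: rel_C_sub.
- exact: rel_C_absorbs.
Qed.

Theorem theorem3p13 (R : realType) (X : metricType R)
    (compactX : compact [set: X])
    (Phi : set (X * R * X)) (semiflowPhi : semiflow_relation Phi)
    (calA : set (X * X) -> set (X * X))
    (calA_GC : calA = rel_G \/ calA = rel_C) :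
  (forall A B : set X,
     closed A -> closed B -> A `&` B = set0 ->
     rel_invariant (phiI Phi `|` calA (phiJ Phi)) A ->
     rel_plus_invariant (rel_inv (phiI Phi `|` calA (phiJ Phi))) B ->
     exists L : X -> R,
       [/\ continuous L,
           (forall x, 0 <= L x <= 1),
           B = L @^-1` [set 0],
           A = L @^-1` [set 1] &
           (forall x y, (phiI Phi `|` calA (phiJ Phi)) (x, y) -> x <> y ->
              L x <= L y /\
              (L x = L y ->
                 [\/ A x /\ A y, B x /\ B y | calA (phiJ Phi) (y, x)]))]
       /\ [/\ lyapunov_function (calA (phiJ Phi)) L,
              cyclic_set (calA (phiJ Phi))
                `<=` critical_set (calA (phiJ Phi)) L &
              critical_set (calA (phiJ Phi)) L
                `<=` cyclic_set (calA (phiJ Phi)) `|` A `|` B])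
  /\
  (exists L : X -> R,
     [/\ continuous L,
         (forall x, 0 <= L x <= 1) &
         (forall x y, (phiI Phi `|` calA (phiJ Phi)) (x, y) -> x <> y ->
            L x <= L y /\ (L x = L y -> calA (phiJ Phi) (y, x)))]
     /\ (lyapunov_function (calA (phiJ Phi)) L /\
         critical_set (calA (phiJ Phi)) L = cyclic_set (calA (phiJ Phi)))).
Proof.
have [cP tP JP aP] := operator_props compactX calA_GC
  (closed_phiJ semiflowPhi) (phiJ_phiI semiflowPhi) (phiI_phiJ semiflowPhi).
(* From now on the operator is an arbitrary relation P with these four
   properties. *)
move: (calA _) => P in cP tP JP aP *.
have /rel_transitiveP tP' := tP.
set F := phiI Phi `|` P.
have cF : closed F by exact: closed_phiIU.
have rF : forall x, F (x, x) by move=> x; exact: phiIU_refl.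
have tF : forall x y z, F (x, y) -> F (y, z) -> F (x, z).
  by move=> x y z; exact: phiIU_trans.
match goal with |- ?G /\ _ => have partA : G end.
  move=> A B cA cB AB0 invA invB.
  have upA : up_closed F A.
    by move=> x y Ax Fxy; rewrite -invA; exists x.
  have downB : down_closed F B by move=> x y By Fxy; apply: invB; exists y.
  have [L [cL L01 Lm _ _] [LB LA Lstrict]] :=
    strict_lyapunov compactX cF rF tF cA cB AB0 upA downB.
  have strict x y : F (x, y) -> x <> y -> L x = L y ->
      [\/ A x /\ A y, B x /\ B y | P (y, x)].
    move=> Fxy xy /(Lstrict _ _ Fxy)[?|?|Fyx]; [exact: Or31|exact: Or32|].
    by apply: Or33; exact: phiIU_sym Fxy Fyx.
  have PF : P `<=` F by move=> ? ?; right.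
  exists L; split; first by split=> // x y Fxy xy; split; [exact: Lm|exact: strict].
  split; first by split=> // x y /PF /Lm.
    exact: cyclic_critical.
  move=> x critx; apply: contrapT => nx; move: critx.
  have [nPxx nAx nBx] : [/\ ~ P (x, x), ~ A x & ~ B x].
    by split=> h; apply: nx; [left; left|left; right|right].
  apply: noncritical => // y Pxy; rewrite lt_neqAle Lm ?andbT; try exact: PF.
    apply/eqP => Lxy; have xy : x <> y by move=> xy; rewrite xy in Pxy nPxx.
    have [[]|[]|Pyx] := strict _ _ (PF _ Pxy) xy Lxy; [by []|by []|].
    exact: nPxx (tP' _ _ _ Pxy Pyx).
  apply/eqP => Lxy; have xy : y <> x by move=> xy; rewrite xy in Pxy nPxx.
  have [[]|[]|Pyx] := strict _ _ (PF _ Pxy) xy Lxy; [by []|by []|].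
  exact: nPxx (tP' _ _ _ Pyx Pxy).
split=> //.
have [|||||L [[cL L01 _ _ Ls] [lL cyc crit]]] := partA set0 set0.
- exact: closed0.
- exact: closed0.
- exact: set0I.
- by rewrite /rel_invariant /rel_image bigcup_set0.
- by rewrite /rel_plus_invariant /rel_image bigcup_set0.
exists L; split; last first.
  by split=> //; apply/seteqP; split=> // x /crit; rewrite !setU0.
split=> // x y Fxy xy; have [Lxy eqL] := Ls _ _ Fxy xy.
by split=> // /eqL [[]|[]|].
Qed.
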